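(* Let $u$ be a solution of $$\partial_t u(x,t)=c\Delta u(x,t)+\int_{\Omega}\big(u(y,t)-\Theta\big)_+\,K(x,y)\,dy\qquad\text{in }\Omega\times(0,+\infty)$$ such that $u(x,0)\le\Theta$ for all $x\in\Omega$ and $u(x,t)\le\Theta$ for all $x\in\partial\Omega$ and $t\in[0,+\infty)$. Then $u(x,t)\le\Theta$ for all $x\in\Omega$ and $t\in[0,+\infty)$.
   Context: $\Omega\subset\mathbb{R}^n$ is a bounded and smooth domain, $c\in(0,+\infty)$, $\Theta\in\mathbb{R}$, and $r_+:=\max\{r,0\}$ for $r\in\mathbb{R}$. The Laplacian $\Delta$ acts in the space variable $x$. The kernel $K:\Omega\times\Omega\to[0,+\infty)$ is measurable, nonnegative and integrable, with $\sup_{x\in\Omega}\int_\Omega K(x,y)\,dy<+\infty$. Solutions are classical: $u:\overline\Omega\times[0,+\infty)\to\mathbb{R}$ is continuous, for every $x\in\Omega$ the map $(0,+\infty)\ni t\mapsto u(x,t)$ is continuously differentiable, and for every $t\in(0,+\infty)$ the map $\Omega\ni x\mapsto u(x,t)$ is twice continuously differentiable. *)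

(* Defs.v *)
From HB Require Import structures.
From mathcomp Require Import all_boot all_order all_algebra.
From mathcomp Require Import all_classical all_reals all_analysis.

Set Implicit Arguments.
Unset Strict Implicit.
Unset Printing Implicit Defensive.

Import Order.TTheory GRing.Theory Num.Theory.
Import numFieldNormedType.Exports.

Local Open Scope classical_set_scope.
Local Open Scope ring_scope.

(* Throughout, R^n with n >= 1 is ['rV[R]_n.+1]. *)

Section lebesgue_rV.
Context (R : realType) (n : nat).
Local Notation V := 'rV[R]_n.+1.
Local Open Scope ereal_scope.

Definition box (p : V * V) : set V :=
  [set x | forall i, (p.1 ord0 i <= x ord0 i < p.2 ord0 i)%R].

Definition box_volume (p : V * V) : R :=
  (\prod_(i < n.+1) Num.max (p.2 ord0 i - p.1 ord0 i) 0)%R.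

Definition box_cover (A : set V) : set (V * V)^nat :=
  [set F | A `<=` \bigcup_k box (F k)].

Definition lebesgue_outer (A : set V) : \bar R :=
  ereal_inf [set \sum_(k <oo) (box_volume (F k))%:E | F in box_cover A].

Lemma box_volume_ge0 p : 0 <= (box_volume p)%:E.
Proof.
by rewrite lee_fin; apply: prodr_ge0 => i _; rewrite le_max lexx orbT.
Qed.

Lemma lebesgue_outer_ge0 A : 0 <= lebesgue_outer A.
Proof.
apply: le_ereal_inf_tmp => _ [F _ <-].
by apply: nneseries_ge0 => *; exact: box_volume_ge0.
Qed.

Lemma lebesgue_outer0 : lebesgue_outer set0 = 0.
Proof.
apply/eqP; rewrite eq_le lebesgue_outer_ge0 andbT.
apply: ereal_inf_lbound; exists (fun=> (0%R, 0%R)); first exact: sub0set.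
rewrite eseries0// => k _ _; congr EFin.
by rewrite /box_volume big_ord_recl /= subrr maxxx mul0r.
Qed.

Lemma le_lebesgue_outer :
  {homo lebesgue_outer : A B / A `<=` B >-> A <= B}.
Proof.
move=> A B AB; apply/ereal_inf_le_tmp => _ [F BF <-].
by exists F => //; exact: subset_trans AB BF.
Qed.

Lemma lebesgue_outer_sigma_subadditive : sigma_subadditive lebesgue_outer.
Proof.
move=> A; have [[i ioo]|] := pselect (exists i, lebesgue_outer (A i) = +oo).
  rewrite (eseries_pinfty _ _ ioo) ?leey// => k _.
  by rewrite -ltNye (lt_le_trans _ (lebesgue_outer_ge0 _)).
rewrite -forallNE => Aoo.
suff add2e (e : {posnum R}) : lebesgue_outer (\bigcup_k A k) <=
    \sum_(i <oo) lebesgue_outer (A i) + e%:num%:E.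
  by apply/lee_addgt0Pr => _/posnumP[].
rewrite (le_trans _ (epsilon_trick _ _ _))//; last first.
  by move=> k; exact: lebesgue_outer_ge0.
pose mu p := (box_volume p)%:E.
pose P k (B : (V * V)^nat) := box_cover (A k) B /\
  \sum_(j <oo) mu (B j) <= lebesgue_outer (A k) + (e%:num / (2 ^ k.+1)%:R)%:E.
have [G PG] : {G : ((V * V)^nat)^nat & forall k, P k (G k)}.
  apply: (@choice _ _ P) => k; rewrite /P /lebesgue_outer.
  set S := (X in ereal_inf X); move infS : (ereal_inf S) => iS.
  case: iS infS => [r Sr|Soo|Soo].
  - have en1 : (0 < e%:num / (2 ^ k.+1)%:R)%R by [].
    have /(lb_ereal_inf_adherent en1) : ereal_inf S \is a fin_num by rewrite Sr.
    move=> [x [B AnB muBx] xS].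
    by exists B; split => //; rewrite muBx -Sr; exact/ltW.
  - by have := Aoo k; rewrite /lebesgue_outer Soo.
  - suff : lbound S 0 by move/le_ereal_inf_tmp; rewrite Soo.
    move=> /= _ [B AnB <-].
    by apply: nneseries_ge0 => *; exact: box_volume_ge0.
have muG_ge0 x : 0 <= (mu \o uncurry G) x by exact: box_volume_ge0.
apply: (@le_trans _ _ (\esum_(i in setT) (mu \o uncurry G) i)).
  apply: ereal_inf_lbound => /=.
  have /card_esym/ppcard_eqP[f] := card_nat2.
  exists (uncurry G \o f).
    apply: (@subset_trans _  (\bigcup_k \bigcup_j box (G k j))) => [t [i _]|].
      by move=> /(PG i).1 -[j _ ?]; exists i => //; exists j.
    move=> t [i _ [j _ Bijt]]; exists (f^-1%FUN (i, j)) => //=.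
    by rewrite invK ?inE.
  rewrite -(esum_pred_image (mu \o uncurry G) _ xpredT) ?[fun=> _]set_true//.
  by rewrite image_eq.
rewrite (_ : esum _ _ = \sum_(i <oo) \sum_(j <oo ) mu (G i j)); last first.
  pose J : nat -> set (nat * nat) := fun i => [set (i, j) | j in setT].
  rewrite (_ : setT = \bigcup_k J k); last first.
    by rewrite predeqE => -[a b]; split => // _; exists a => //; exists b.
  rewrite esum_bigcupT /=; last 2 first.
    - apply/trivIsetP => i j _ _ ij.
      rewrite predeqE => -[k m] /=; split => //= -[] [_] _ [<-{k} _].
      by move=> [m' _] [] /esym/eqP; rewrite (negbTE ij).
    - by move=> /= [k m]; exact: box_volume_ge0.
  rewrite -(image_id [set: nat]) -fun_true esum_pred_image//; last first.
    by move=> k _; apply: esum_ge0 => p _; exact: muG_ge0.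
  apply: eq_eseriesr => /= j _.
  rewrite -(esum_pred_image (mu \o uncurry G) (pair j) predT)//=; last 2 first.
    - by move=> i _; exact: box_volume_ge0.
    - by move=> ? ? _ _; exact: (@can_inj _ _ _ snd).
  by congr esum; rewrite predeqE => -[a b]; split; move=> [i _ <-]; exists i.
apply: lee_lim.
- apply: is_cvg_nneseries => k *.
  by apply: nneseries_ge0 => m *; exact: (muG_ge0 (k, m)).
- by apply: is_cvg_nneseries => k *; apply: adde_ge0 => //;
    exact: lebesgue_outer_ge0.
- by near=> k; apply: lee_sum => i _; exact: (PG i).2.
Unshelve. all: by end_near. Qed.

HB.instance Definition _ := isOuterMeasure.Build R V lebesgue_outer
  lebesgue_outer0 lebesgue_outer_ge0 le_lebesgue_outer
  lebesgue_outer_sigma_subadditive.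

(* Lebesgue measure on R^(n+1); its measurable sets are the
   Lebesgue-measurable ones, in the sense of Caratheodory. *)
Definition lebesgue_rV :
    {measure set (caratheodory_type lebesgue_outer) -> \bar R} :=
  let mu : {outer_measure set V -> \bar R} := lebesgue_outer in
  (mu : set (caratheodory_type mu) -> \bar R).

End lebesgue_rV.
Arguments lebesgue_rV R n : clear implicits.

Section regularity.
Context (R : realType) (n : nat).
Local Notation V := 'rV[R]_n.+1.
Implicit Types (f : V -> R) (D : set V).

Definition pderiv (i : 'I_n.+1) f : V -> R :=
  fun x => 'D_(delta_mx ord0 i) f x.

Definition laplacian f : V -> R :=
  fun x => \sum_(i < n.+1) pderiv i (pderiv i f) x.

(* [f] is of class C^k on the open set [D]. *)
Fixpoint class_C (k : nat) D f : Prop :=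
  {in D, continuous f} /\
  if k is k'.+1 then
    forall i : 'I_n.+1,
      (forall x, D x -> derivable f x (delta_mx ord0 i)) /\
      class_C k' D (pderiv i f)
  else True.

Definition class_Coo D f : Prop := forall k, class_C k D f.

Definition boundary D : set V := closure D `\` interior D.

(* Near each boundary point, up to relabeling and reorienting the axes, [D] is
   the region above the graph of a C^oo function [g] of the remaining
   coordinates [col' i x]; smoothness of [g] is expressed through the function
   [x |-> g (col' i x)], which is constant in the i-th coordinate. *)
Definition smooth_boundary D : Prop :=
  forall z, boundary D z ->
  exists (i : 'I_n.+1) (g : 'rV[R]_n -> R) (above : bool),
    class_Coo setT (fun x : V => g (col' i x)) /\
    \forall x \near z,
      D x <-> if above then g (col' i x) < x ord0 i else x ord0 i < g (col' i x).

Record bounded_smooth_domain D : Prop := {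
  domain_neq0 : D !=set0;
  domain_open : open D;
  domain_connected : connected D;
  domain_bounded : bounded_set D;
  domain_smooth : smooth_boundary D
}.

End regularity.

Section nonlocal_equation.
Context (R : realType) (n : nat).
Local Notation V := 'rV[R]_n.+1.
Implicit Types (Omega : set V) (K : V -> V -> R) (u : V -> R -> R).

(* Only the values of [K] on [Omega * Omega] matter. As a function on
   [Omega * Omega], [K] is viewed on R^(2(n+1)) through
   [z |-> (lsubmx z, rsubmx z)]; [integrable] includes measurability. *)
Record admissible_kernel Omega K : Prop := {
  kernel_ge0 : forall x y, Omega x -> Omega y -> 0 <= K x y;
  kernel_integrable : (lebesgue_rV R (n + n.+1)).-integrable
    [set z : 'rV[R]_(n.+1 + n.+1) | Omega (lsubmx z) /\ Omega (rsubmx z)]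
    (fun z : 'rV[R]_(n.+1 + n.+1) => (K (lsubmx z) (rsubmx z))%:E);
  kernel_sup : (ereal_sup
    [set \int[lebesgue_rV R n]_(y in Omega) (K x y)%:E | x in Omega] < +oo)%E
}.

(* Only the values of [u] on [closure Omega * [0, +oo[] matter. *)
Record classical_regularity Omega u : Prop := {
  classical_continuous :
    {within closure Omega `*` `[0, +oo[%classic,
      continuous (fun p : V * R => u p.1 p.2)};
  classical_C1_time : forall x, Omega x ->
    (forall t, 0 < t -> derivable (u x) t 1) /\
    {in `]0, +oo[%classic, continuous (derive1 (u x))};
  classical_C2_space : forall t, 0 < t -> class_C 2 Omega (u ^~ t)
}.

Record classical_solution Omega (c Theta : R) K u : Prop := {
  solution_regular : classical_regularity Omega u;
  solution_equation : forall x t, Omega x -> 0 < t ->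
    derive1 (u x) t = c * laplacian (u ^~ t) x +
      \int[lebesgue_rV R n]_(y in Omega) (Num.max (u y t - Theta) 0 * K x y)
}.

End nonlocal_equation.

(* Main.v *)
Require Import Defs.
From HB Require Import structures.
From mathcomp Require Import all_boot all_order all_algebra.
From mathcomp Require Import all_classical all_reals all_analysis.
From mathcomp Require Import lra.

Import Order.TTheory GRing.Theory Num.Theory.
Import numFieldNormedType.Exports.

Local Open Scope classical_set_scope.
Local Open Scope ring_scope.

(** The claim is a maximum principle for the time-weighted excess
    v(x, t) = exp(- l t) (u(x, t) - Theta), where l = k + 1 and k bounds the
    integrals of K(x, .) over Omega.

    Suppose that u(x, T) > Theta somewhere in Omega. On the compact set
    closure Omega * [0, T] the continuous function v attains its maximum, which
    is then positive, at some (z, s). The initial and boundary conditions force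
    z in Omega and s > 0. Put M = u(z, s) - Theta > 0. At (z, s):
    - the time derivative of v is nonnegative, even if s = T, because v(z, .)
      does not exceed its value at s to the left of s
      ([derive_ge0_left_max]); that is, l M <= d_t u(z, s);
    - u(., s) is maximal at z on Omega, so that its Laplacian is at most 0
      ([laplacian_le0_at_max]);
    - (u(., s) - Theta)_+ <= M on Omega, again by maximality, so that the
      nonlocal term is at most k M ([Rintegral_le_scale]).
    The equation now gives l M <= k M with l > k and M > 0, a contradiction.
    The weight exp(- l t) is what makes the linear growth rate k of the nonlocal
    term harmless.

    A section K(x, .) of a jointly measurable kernel is measurable only for
    almost every x, whereas the equation is used at the one point z, which is
    not free to choose. The estimate of the nonlocal term therefore works with
    integrals of functions that need not be measurable. *)

(** The integral of a nonnegative function, measurable or not, is the supremum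
    of the integrals of the simple functions below it; a simple function h <= f
    gives the simple function h / M <= g, hence the bound. *)
Lemma ge0_le_integral_scale d (T : measurableType d) (R : realType)
    (mu : {measure set T -> \bar R}) (D : set T) (f g : T -> \bar R) (M : R) :
    0 < M -> (forall x, D x -> 0 <= f x)%E -> (forall x, D x -> 0 <= g x)%E ->
    (forall x, D x -> f x <= M%:E * g x)%E ->
  (\int[mu]_(x in D) f x <= M%:E * \int[mu]_(x in D) g x)%E.
Proof.
move=> M0 f0 g0 fg.
rewrite !ge0_integralE//; apply: ge_ereal_sup => _ [h /= hf <-].
have Mi0 : 0 <= M^-1 by rewrite invr_ge0 ltW.
rewrite -lee_pdivrMl//.
rewrite -sintegralrM.
apply: ereal_sup_ubound => /=.
exists (scale_nnsfun h Mi0) => // x /=.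
rewrite EFinM lee_pdivrMl//; apply: le_trans (hf x) _.
rewrite /patch; case: ifPn => [|_]; last by rewrite mule0.
by rewrite inE => /fg.
Qed.

(** The difference quotients with negative step h > a - c are nonnegative, and
    so is their limit. *)
Lemma derive_ge0_left_max (R : realFieldType) (f : R -> R) (a c : R) :
    a < c -> derivable f c 1 -> (forall t, a < t < c -> f t <= f c) ->
  0 <= 'D_1 f c.
Proof.
move=> ac dfc fmax.
rewrite ['D_1 f c]cvg_at_leftE//.
apply: limr_ge.
  rewrite -(cvg_at_leftE (fun h : R => h^-1 *: ((f \o shift c) _ - f c)))//.
  apply: cvg_trans dfc; apply: cvg_app.
  move=> A [e egt0 Ae]; exists e => // x xe xlt0; apply: Ae => //.
  exact/ltr0_neq0.
near=> h.
have h0 : h < 0 by near: h; exists 1 => /=.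
apply: mulr_le0; first by rewrite invr_le0 ltW.
rewrite subr_le0 [_%:A]mulr1; apply: fmax; rewrite gtrDr h0 andbT -ltrBlDr.
near: h; exists (c - a); first by rewrite /= subr_gt0.
by move=> h /=; rewrite sub0r normrN ltr_norml opprB => /andP[].
Unshelve. all: by end_near. Qed.

(** Only the derivative of df at the single point c is available, not the
    continuity of a second derivative. If it were positive, then, as df c = 0,
    df would be positive just to the right of c, and by the mean value theorem
    f would exceed f c there. *)
Lemma derive2_le0_at_max (R : realType) (f df : R -> R) (c e : R) :
    0 < e -> (forall x, `|x - c| < e -> is_derive x 1 f (df x)) ->
    derivable df c 1 -> (forall x, `|x - c| < e -> f x <= f c) ->
  'D_1 df c <= 0.
Proof.
move=> e0 fdf ddf fmax; rewrite leNgt; apply/negP => D0.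
have inI x : x \in `]c - e, c + e[%R -> `|x - c| < e.
  by rewrite in_itv/= => /andP[? ?]; rewrite ltr_norml; lra.
have dfc0 : df c = 0.
  have fc : is_derive c 1 f (df c) by apply: fdf; rewrite subrr normr0.
  have fc0 : is_derive c 1 f 0.
    apply: (@derive1_at_max _ _ (c - e) (c + e)).
    - lra.
    - by move=> t /inI/fdf[].
    - by rewrite in_itv/=; lra.
    - by move=> t /inI/fmax.
  by rewrite -(@derive_val _ _ _ _ _ _ _ fc) (@derive_val _ _ _ _ _ _ _ fc0).
have [d /= d0 dP] : \forall h \near 0^', 0 < h^-1 *: (df (h *: 1 + c) - df c).
  exact: (@cvgr_gt _ _ _ _ _ _ ddf).
(* Half of the minimum keeps the closed interval [c, c + h] inside both open
   balls around c, of radius d and of radius e. *)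
pose h := Num.min d e / 2.
have [hd he h0] : [/\ h < d, h < e & 0 < h].
  have m0 : 0 < Num.min d e by rewrite lt_min d0 e0.
  have : Num.min d e <= d by rewrite ge_min lexx.
  have : Num.min d e <= e by rewrite ge_min lexx orbT.
  by rewrite /h; split; lra.
have close x : x \in `[c, c + h]%R -> `|x - c| < e.
  by rewrite in_itv/= => /andP[? ?]; rewrite ltr_norml; lra.
have [|x||x xI fE] := @MVT _ f df c (c + h).
- by rewrite ltrDl.
- move=> /[!in_itv]/= /andP[cx xh]; apply/fdf/close.
  by rewrite in_itv/=; lra.
- apply: derivable_within_continuous => x /close.
  by move=> /fdf[].
move: xI; rewrite in_itv/= => /andP[cx xh].
have /dP : ball 0 d (x - c).
  by rewrite /ball/= sub0r normrN ger0_norm; lra.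
have xc0 : 0 < x - c by rewrite subr_gt0.
move=> /(_ (lt0r_neq0 xc0)).
rewrite [_ *: 1]mulr1 subrK dfc0 subr0 pmulr_rgt0 ?invr_gt0// => dfx.
have : f (c + h) <= f c.
  by apply/fmax/close; rewrite in_itv/= lerDl ltW //= lexx.
rewrite -subr_le0 fE (_ : c + h - c = h) ?pmulr_lle0 ?leNgt ?dfx//.
by rewrite addrC addKr.
Qed.

(** With its companion [derive_on_line], this turns partial derivatives at every
    point of a line into derivatives of one function of a real variable, to
    which the one-dimensional second derivative test applies. *)
Lemma derivable_on_line (R : numFieldType) (V : normedModType R) (f : V -> R)
    (x v : V) (s : R) :
    derivable f (s *: v + x) v = derivable (fun r : R => f (r *: v + x)) s 1.
Proof.
rewrite /derivable; set g1 := fun h => h^-1 *: _; set g2 := fun h => h^-1 *: _.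
suff -> : g1 = g2 by [].
by apply/funext => h; rewrite /g1 /g2 /= [_ *: 1]mulr1 scalerDl addrA.
Qed.

Lemma derive_on_line (R : numFieldType) (V : normedModType R) (f : V -> R)
    (x v : V) (s : R) :
  'D_v f (s *: v + x) = 'D_1 (fun r : R => f (r *: v + x)) s.
Proof.
rewrite /derive; set g1 := fun h => h^-1 *: _; set g2 := fun h => h^-1 *: _.
suff -> : g1 = g2 by [].
by apply/funext => h; rewrite /g1 /g2 /= [_ *: 1]mulr1 scalerDl addrA.
Qed.

(** Each pure second derivative is nonpositive, by the second derivative test
    along the corresponding coordinate line. *)
Lemma laplacian_le0_at_max (R : realType) (n : nat) (D : set 'rV[R]_n.+1)
    (f : 'rV[R]_n.+1 -> R) (x : 'rV[R]_n.+1) :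
    open D -> D x -> class_C 2 D f -> (forall y, D y -> f y <= f x) ->
  laplacian f x <= 0.
Proof.
move=> oD Dx [_ fC] fmax; apply: sumr_le0 => i _.
have [fD [_ /(_ i)[dfD _]]] := fC i.
pose v : 'rV[R]_n.+1 := delta_mx ord0 i.
have [e e0 eD] : exists2 e : R, 0 < e & forall s, `|s| < e -> D (s *: v + x).
  have : \forall s \near (0 : R), D (s *: v + x).
    have cv : (fun s : R => s *: v + x) @ (0 : R) --> 0 *: v + x.
      by apply: cvgD; [apply: cvgZr_tmp; exact: cvg_id|exact: cvg_cst].
    rewrite scale0r add0r in cv.
    by apply: cv; exact: open_nbhs_nbhs.
  move=> [e /= e0 eD]; exists e => // s se; apply: eD.
  by rewrite /ball/= sub0r normrN.
have x0 : x = 0 *: v + x by rewrite scale0r add0r.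
rewrite {1}/pderiv [X in 'D_ _ _ X]x0 derive_on_line.
apply: (@derive2_le0_at_max _ (fun s : R => f (s *: v + x)) _ 0 e) => //.
- move=> s; rewrite subr0 => /eD /fD fs.
  by rewrite /pderiv derive_on_line; apply: derivableP; rewrite -derivable_on_line.
- by rewrite -derivable_on_line -x0; exact: dfD.
- by move=> s; rewrite subr0 scale0r add0r => /eD/fmax.
Qed.

Lemma Rintegral_le_scale d (T : measurableType d) (R : realType)
    (mu : {measure set T -> \bar R}) (D : set T) (f g : T -> R) (M k : R) :
    0 < M -> (forall x, D x -> 0 <= f x) -> (forall x, D x -> 0 <= g x) ->
    (forall x, D x -> f x <= M * g x) ->
    (\int[mu]_(x in D) (g x)%:E <= k%:E)%E ->
  \int[mu]_(x in D) f x <= M * k.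
Proof.
move=> M0 f0 g0 fg gk.
have I0 : (0 <= \int[mu]_(x in D) (f x)%:E)%E by exact: integral_ge0.
have Ik : (\int[mu]_(x in D) (f x)%:E <= (M * k)%:E)%E.
  rewrite EFinM; apply: le_trans (lee_wpmul2l _ gk); last by rewrite lee_fin ltW.
  by apply: ge0_le_integral_scale.
rewrite /Rintegral -lee_fin fineK// ge0_fin_numE//.
exact: le_lt_trans Ik (ltry _).
Qed.

Lemma bounded_closure (R : realFieldType) (V : normedModType R) (D : set V) :
  bounded_set D -> bounded_set (closure D).
Proof.
move=> [M [Mr DM]]; exists M; split => // x Mx.
have /closure_id -> : closed [set y : V | `|y| <= x].
  have := @closed_comp _ _ (fun y : V => `|y|) [set r | r <= x].
  apply; last exact: closed_le.
  by move=> y _; exact: norm_continuous.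
by apply: closureS; exact: DM.
Qed.

Theorem lemma2p2 (R : realType) (n : nat) (Omega : set 'rV[R]_n.+1)
    (c Theta : R) (K : 'rV[R]_n.+1 -> 'rV[R]_n.+1 -> R)
    (u : 'rV[R]_n.+1 -> R -> R)
    (hOmega : bounded_smooth_domain Omega) (hc : 0 < c)
    (hK : admissible_kernel Omega K)
    (hu : classical_solution Omega c Theta K u)
    (hinit : forall x : 'rV[R]_n.+1, Omega x -> u x 0 <= Theta)
    (hbdry : forall (x : 'rV[R]_n.+1) (t : R), boundary Omega x -> 0 <= t ->
      u x t <= Theta) :
  forall (x : 'rV[R]_n.+1) (t : R), Omega x -> 0 <= t -> u x t <= Theta.
Proof.
have [[x_ Ox_] oO _ bO _] := hOmega.
have [[ucont uC1 uC2] ueq] := hu.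
have [K0 _ Ksup] := hK.
have [k k0 kP] : exists2 k : R, 0 <= k & forall x, Omega x ->
    (\int[lebesgue_rV R n]_(y in Omega) (K x y)%:E <= k%:E)%E.
  set S := ereal_sup _ in Ksup.
  have I0 x : Omega x -> (0 <= \int[lebesgue_rV R n]_(y in Omega) (K x y)%:E)%E.
    by move=> Ox; apply: integral_ge0 => y Oy; rewrite lee_fin K0.
  have IS x : Omega x -> (\int[lebesgue_rV R n]_(y in Omega) (K x y)%:E <= S)%E.
    by move=> Ox; apply: ereal_sup_ubound; exists x.
  have S0 : (0 <= S)%E := le_trans (I0 _ Ox_) (IS _ Ox_).
  exists (fine S); first exact: fine_ge0.
  by move=> x Ox; rewrite fineK; [exact: IS|rewrite ge0_fin_numE].
move=> x T Ox T0; rewrite leNgt; apply/negP => uT.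
(* Any rate l > k would do. *)
pose l := k + 1.
pose v (p : 'rV[R]_n.+1 * R) := expR (- l * p.2) * (u p.1 p.2 - Theta).
pose Q := closure Omega `*` `[0, T]%classic.
have [[z s] Qp vmax] : exists2 p, p \in Q & forall q, q \in Q -> v q <= v p.
  apply: compact_EVT_max.
  - exists (x, T); split => /=; first exact: subset_closure.
    by rewrite in_itv/= T0 lexx.
  - apply: compact_setX; last exact: segment_compact.
    by apply: bounded_closed_compact; [exact: bounded_closure|exact: closed_closure].
  - have cexp : continuous (fun p : 'rV[R]_n.+1 * R => expR (- l * p.2)).
      move=> p; apply: continuous_comp; last exact: continuous_expR.
      by apply: cvgM; [exact: cvg_cst|exact: cvg_snd].
    have ucontQ : {within Q, continuous (fun p => u p.1 p.2)}.
      apply: continuous_subspaceW ucont => -[y t] [/= Oy].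
      by rewrite !in_itv/= => /andP[t0 _]; split; rewrite /= ?in_itv/= ?t0.
    move=> p; apply: cvgM; first exact: (continuous_subspaceT cexp).
    by apply: cvgB; [exact: ucontQ|exact: cvg_cst].
move: Qp; rewrite inE => -[/= Oz]; rewrite in_itv/= => /andP[s0 sT].
pose M := u z s - Theta.
have vle y t : closure Omega y -> 0 <= t <= T ->
    expR (- l * t) * (u y t - Theta) <= expR (- l * s) * M.
  by move=> Oy tT; apply: (vmax (y, t)); rewrite inE; split => //=; rewrite in_itv.
have M0 : 0 < M.
  rewrite -(pmulr_rgt0 _ (expR_gt0 (- l * s))).
  apply: lt_le_trans (vle x T _ _).
  - by rewrite mulr_gt0 ?expR_gt0// subr_gt0.
  - exact: subset_closure.
  - by rewrite T0 lexx.
(* The maximum is positive, so that it is not on the parabolic boundary, where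
   u <= Theta. *)
have {}Oz : Omega z.
  have [//|nOz] := pselect (Omega z).
  have : boundary Omega z by split => // /interior_subset.
  by move=> /hbdry/(_ s0); move: M0; rewrite /M; lra.
have {}s0 : 0 < s.
  rewrite lt_neqAle s0 andbT; apply/eqP => s0'.
  by have := hinit _ Oz; move: M0; rewrite /M -s0'; lra.
have umax y : Omega y -> u y s <= u z s.
  move=> Oy; have := vle y s (subset_closure Oy).
  by rewrite ltW//= => /(_ sT); rewrite ler_pM2l ?expR_gt0// /M; lra.
have lap : laplacian (u ^~ s) z <= 0.
  by apply: laplacian_le0_at_max oO Oz (uC2 _ s0) umax.
have nonlocal_le : \int[lebesgue_rV R n]_(y in Omega)
    (Num.max (u y s - Theta) 0 * K z y) <= M * k.
  apply: (@Rintegral_le_scale _ _ _ (lebesgue_rV R n) Omega _ (K z) M k) => //.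
  - by move=> y Oy; rewrite mulr_ge0 ?K0// le_max lexx orbT.
  - by move=> y Oy; exact: K0.
  - move=> y Oy; rewrite ler_wpM2r ?K0// ge_max (ltW M0) andbT /M.
    by rewrite lerB ?umax.
  - exact: kP.
have du : is_derive s 1 (u z) (derive1 (u z) s).
  by rewrite derive1E; apply: derivableP; exact: (uC1 _ Oz).1.
have dv : is_derive s 1 (fun t => expR (- l * t) * (u z t - Theta))
    (expR (- l * s) * (derive1 (u z) s - l * M)).
  have dl : is_derive s 1 (fun t : R => - l * t) (- l).
    by apply: is_derive_eq; rewrite [LHS]mulr1.
  have de : is_derive s 1 (fun t : R => expR (- l * t)) (expR (- l * s) * - l).
    exact: is_derive1_comp (is_derive_expR _) dl.
  have dw : is_derive s 1 (fun t : R => u z t - Theta) (derive1 (u z) s - 0).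
    exact: is_deriveB du (is_derive_cst _ _ _).
  apply: is_derive_eq (is_deriveM de dw) _.
  by rewrite /GRing.scale/= /M; lra.
have : 0 <= expR (- l * s) * (derive1 (u z) s - l * M).
  rewrite -(@derive_val _ _ _ _ _ _ _ dv).
  apply: (@derive_ge0_left_max _ _ 0) => // t /andP[t0 ts].
  by apply: vle; [exact: subset_closure|rewrite ltW//= (le_trans (ltW ts))].
rewrite pmulr_rge0 ?expR_gt0// ueq// /l.
have := mulr_ge0_le0 (ltW hc) lap.
lra.
Qed.
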